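(* Let $P\subseteq\mathbb{R}^d$ be a $d$-polytope and let $\mathcal{C}$ be a set of (nonempty) faces of $P$. Then the identity $\prod_{F\in\mathcal{C}}([P]-[F])=0$ holds in the Minkowski ring of $P$ and its faces if and only if $\mathcal{C}$ covers all the vertices of $P$, i.e. every vertex of $P$ lies in some $F\in\mathcal{C}$.
   Context: For $S\subseteq W=\mathbb{R}^d$, $[S]:W\to\mathbb{C}$ denotes its indicator function. $M(\mathcal{P}(W))$ is the complex vector space of functions on $W$ spanned by indicator functions of closed convex polyhedra, a commutative $\mathbb{C}$-algebra with the well-defined bilinear product determined by $[A]\cdot[B]=[A+B]$ (Minkowski sum) for nonempty closed convex polyhedra, with unit $[\{0\}]$. The Minkowski face ring $M(\mathcal{F}(P))$ is the unital $\mathbb{C}$-subalgebra generated by the indicator functions of the nonempty closed faces of $P$, including $P$ itself. The product in the claim is the product in this ring. *)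

(* Defs.v *)
From HB Require Import structures.
From mathcomp Require Import all_boot all_order all_algebra.
From mathcomp Require Import complex.
From mathcomp Require Import all_classical all_reals all_analysis.
From mathcomp Require Import lra.
Set Implicit Arguments.
Unset Strict Implicit.
Unset Printing Implicit Defensive.
Import Order.TTheory GRing.Theory Num.Theory.
Import numFieldNormedType.Exports.
Local Open Scope classical_set_scope.
Local Open Scope ring_scope.

Section Polyhedra.
Context {R : realType}.
Implicit Types d : nat.

Definition dotv d (a x : 'rV[R]_d) : R := (a *m x^T) 0 0.

Lemma dotvE d (a x : 'rV[R]_d) : dotv a x = \sum_i a 0 i * x 0 i.
Proof. by rewrite /dotv mxE; apply: eq_bigr => i _; rewrite mxE. Qed.

Lemma dotvDr d (a x y : 'rV[R]_d) : dotv a (x + y) = dotv a x + dotv a y.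
Proof. by rewrite /dotv linearD mulmxDr mxE. Qed.

Lemma dotvZr d (a x : 'rV[R]_d) t : dotv a (t *: x) = t * dotv a x.
Proof. by rewrite /dotv linearZ /= -scalemxAr mxE. Qed.

Lemma dotvBr d (a x y : 'rV[R]_d) : dotv a (x - y) = dotv a x - dotv a y.
Proof. by rewrite dotvDr -scaleN1r dotvZr mulN1r. Qed.

Lemma dotvDl d (a b x : 'rV[R]_d) : dotv (a + b) x = dotv a x + dotv b x.
Proof. by rewrite /dotv mulmxDl mxE. Qed.

Lemma dotvZl d (a x : 'rV[R]_d) t : dotv (t *: a) x = t * dotv a x.
Proof. by rewrite /dotv -scalemxAl mxE. Qed.

Lemma dotvNl d (a x : 'rV[R]_d) : dotv (- a) x = - dotv a x.
Proof. by rewrite -scaleN1r dotvZl mulN1r. Qed.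

Lemma dotv0l d (x : 'rV[R]_d) : dotv 0 x = 0.
Proof. by rewrite /dotv mul0mx mxE. Qed.

Lemma dotv_sumr d (a : 'rV[R]_d) n (l : 'I_n -> R) (p : 'I_n -> 'rV[R]_d) :
  dotv a (\sum_i l i *: p i) = \sum_i l i * dotv a (p i).
Proof.
elim/big_rec2: _ => [|i y x _ <-].
  by rewrite /dotv trmx0 mulmx0 mxE.
by rewrite dotvDr dotvZr.
Qed.

(* The solution set of finitely many inequalities <a, x> <= b; it may be
   empty. *)
Definition halfspaces d (s : seq ('rV[R]_d * R)) : set 'rV[R]_d :=
  [set x | {in s, forall c, dotv c.1 x <= c.2}].

Definition is_polyhedron d (A : set 'rV[R]_d) : Prop :=
  exists s, A = halfspaces s.

Lemma is_polyhedronT d : is_polyhedron [set: 'rV[R]_d].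
Proof. by exists [::]; apply/seteqP; split. Qed.

Lemma is_polyhedronI d (A B : set 'rV[R]_d) :
  is_polyhedron A -> is_polyhedron B -> is_polyhedron (A `&` B).
Proof.
move=> [s ->] [t ->]; exists (s ++ t); apply/seteqP; split => x.
  by move=> [xs xt] c; rewrite mem_cat => /orP[/xs|/xt].
by move=> H; split=> c cs; apply: H; rewrite mem_cat cs ?orbT.
Qed.

Lemma is_polyhedron_le d (a : 'rV[R]_d) b :
  is_polyhedron [set x | dotv a x <= b].
Proof.
exists [:: (a, b)]; apply/seteqP; split => x /=.
  by move=> H c; rewrite inE => /eqP ->.
by move=> /(_ (a, b)); apply; rewrite inE.
Qed.

Lemma is_polyhedron_eq d (a : 'rV[R]_d) b :
  is_polyhedron [set x | dotv a x = b].
Proof.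
have -> : [set x | dotv a x = b] =
    [set x | dotv a x <= b] `&` [set x | dotv (- a) x <= - b].
  apply/seteqP; split => x /=; rewrite dotvNl lerN2.
    by move=> ->.
  by move=> [? ?]; apply/eqP; rewrite eq_le; apply/andP.
by apply: is_polyhedronI; exact: is_polyhedron_le.
Qed.

Lemma is_polyhedron_bigI d n (A : 'I_n -> set 'rV[R]_d) :
  (forall i, is_polyhedron (A i)) ->
  is_polyhedron [set x | forall i, A i x].
Proof.
move=> /choice[s sA].
exists (flatten [seq s i | i <- enum 'I_n]); apply/seteqP; split => x /=.
  move=> H c /flatten_mapP[i _ cs].
  by have := H i; rewrite sA; apply.
move=> H i; rewrite sA => c cs; apply: H.
by apply/flatten_mapP; exists i => //; rewrite mem_enum.
Qed.

(* Preimages under affine maps. *)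
Lemma is_polyhedron_preimage d n (A : set 'rV[R]_n) (M : 'M[R]_(d, n)) v :
  is_polyhedron A -> is_polyhedron [set x | A (x *m M + v)].
Proof.
move=> [s ->]; exists [seq (c.1 *m M^T, c.2 - dotv c.1 v) | c <- s].
have E c x : dotv (c *m M^T) x = dotv c (x *m M).
  by rewrite /dotv trmx_mul mulmxA.
apply/seteqP; split => x /= H.
  move=> _ /mapP[c cs ->] /=; have := H c cs.
  by rewrite E dotvDr lerBrDr.
move=> c cs; have /= := H _ (map_f _ cs).
by rewrite E dotvDr lerBrDr.
Qed.

Lemma ex_max (s : seq R) (x0 : R) : exists2 t, t \in x0 :: s &
  {in x0 :: s, forall x, x <= t}.
Proof.
elim: s x0 => [|y s IH] x0.
  by exists x0; rewrite ?inE// => x; rewrite inE => /eqP ->.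
have [t ts Ht] := IH y.
have [le|lt] := leP x0 t.
  exists t; first by rewrite inE ts orbT.
  by move=> x; rewrite inE => /orP[/eqP ->//|/Ht].
exists x0; first by rewrite inE eqxx.
move=> x; rewrite inE => /orP[/eqP ->//|/Ht xt].
exact: le_trans xt (ltW lt).
Qed.

Lemma ex_between (L U : seq R) :
  {in L & U, forall l u, l <= u} ->
  exists t, {in L, forall l, l <= t} /\ {in U, forall u, t <= u}.
Proof.
case: L => [|l0 L] LU; last first.
  by have [t tL Ht] := ex_max L l0; exists t; split => // u uU; exact: LU.
case: U {LU} => [|u0 U]; first by exists 0.
have [t tU Ht] := ex_max (map -%R U) (- u0).
exists (- t); split => // u uU; rewrite lerNl; apply: Ht.
by rewrite -map_cons map_f.
Qed.

(* Fourier-Motzkin elimination: the sweep A + R e of a polyhedron. *)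
Definition sweep d (e : 'rV[R]_d) (A : set 'rV[R]_d) : set 'rV[R]_d :=
  [set x | exists t : R, A (x - t *: e)].

Lemma is_polyhedron_sweep d (e : 'rV[R]_d) A :
  is_polyhedron A -> is_polyhedron (sweep e A).
Proof.
move=> [s ->].
pose f (c : 'rV[R]_d * R) := dotv c.1 e.
pose P := [seq c <- s | 0 < f c].
pose N := [seq c <- s | f c < 0].
pose g (p n : 'rV[R]_d * R) :=
  (f p *: n.1 - f n *: p.1, f p * n.2 - f n * p.2).
exists ([seq c <- s | f c == 0] ++ [seq g p n | p <- P, n <- N]).
apply/seteqP; split => x /=.
  move=> [t H] c; rewrite mem_cat => /orP[|/allpairsP[[p n] /= []]].
    rewrite mem_filter => /andP[/eqP fc cs]; have := H c cs.
    by rewrite dotvBr dotvZr -/(f c) fc mulr0 subr0.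
  rewrite !mem_filter => /andP[p0 ps] /andP[n0 ns] ->.
  have := H p ps; have := H n ns; rewrite /= !dotvBr !dotvZr -/(f p) -/(f n).
  rewrite dotvDl dotvNl !dotvZl.
  move: (dotv p.1 x) (dotv n.1 x) => a b h1 h2.
  have : f p * (b - t * f n) <= f p * n.2 by rewrite ler_pM2l.
  have : f n * p.2 <= f n * (a - t * f p) by rewrite ler_nM2l.
  lra.
move=> H.
pose h (c : 'rV[R]_d * R) := (dotv c.1 x - c.2) / f c.
have [|t [tL tU]] := @ex_between (map h P) (map h N).
  move=> _ _ /mapP[p + ->] /mapP[n + ->] => pP nN.
  have := H (g p n); rewrite mem_cat.
  have -> /= : g p n \in [seq g p n | p <- P, n <- N] by exact: allpairs_f.
  rewrite orbT => /(_ isT); rewrite dotvDl dotvNl !dotvZl.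
  move: pP nN; rewrite !mem_filter => /andP[p0 ps] /andP[n0 ns].
  rewrite /h ler_pdivrMr// mulrAC ler_ndivlMr//.
  lra.
exists t => c cs; rewrite dotvBr dotvZr -/(f c).
have [f0|f0|f0] := ltgtP (f c) 0.
- have /tU : h c \in map h N by rewrite map_f// mem_filter f0.
  by rewrite /h ler_ndivlMr//; lra.
- have /tL : h c \in map h P by rewrite map_f// mem_filter f0.
  by rewrite /h ler_pdivrMr//; lra.
have := H c; rewrite f0 mem_cat mem_filter f0 eqxx cs => /(_ isT).
by rewrite mulr0 subr0.
Qed.

Definition sweeps d (es : seq 'rV[R]_d) (A : set 'rV[R]_d) :=
  foldr (@sweep d) A es.

Lemma is_polyhedron_sweeps d (es : seq 'rV[R]_d) A :
  is_polyhedron A -> is_polyhedron (sweeps es A).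
Proof. by move=> PA; elim: es => //= e es; exact: is_polyhedron_sweep. Qed.

Lemma sweepsP d n (es : 'I_n -> 'rV[R]_d) A x (s : seq 'I_n) : uniq s ->
  sweeps (map es s) A x <->
  exists t : 'I_n -> R, A (x - \sum_(i <- s) t i *: es i).
Proof.
elim: s x => [|i s IH] x /=.
  split; first by move=> Ax; exists (fun=> 0); rewrite big_nil subr0.
  by move=> [t]; rewrite big_nil subr0.
move=> /andP[si us]; split.
  move=> [u /IH]-/(_ us)[t At].
  exists (fun j => if j == i then u else t j).
  rewrite big_cons eqxx opprD addrA; congr (A (_ - _)): At.
  apply: eq_big_seq => j js; case: eqP => // ji.
  by rewrite -ji js in si.
move=> [t]; rewrite big_cons opprD addrA => At; exists (t i).
by apply/IH => //; exists t.
Qed.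

Lemma is_polyhedron_exists d n (Q : set 'rV[R]_(d + n)) :
  is_polyhedron Q ->
  is_polyhedron [set x : 'rV[R]_d | exists y : 'rV[R]_n, Q (row_mx x y)].
Proof.
move=> PQ.
pose es (i : 'I_n) : 'rV[R]_(d + n) := row_mx 0 (delta_mx 0 i).
have PS := is_polyhedron_sweeps (map es (enum 'I_n)) PQ.
have := is_polyhedron_preimage (row_mx 1%:M 0 : 'M[R]_(d, d + n)) 0 PS.
congr is_polyhedron; apply/seteqP; split => x /=;
    rewrite mul_mx_row mulmx1 mulmx0 addr0.
  move=> /sweepsP[|t]; first exact: enum_uniq.
  rewrite big_enum/= => At; exists (- \row_i t i); congr Q : At.
  have -> : \sum_i t i *: es i = row_mx 0 (\row_i t i).
    rewrite [\row_i t i]row_sum_delta.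
    under [in RHS]eq_bigr do rewrite mxE.
    elim/big_rec2: _ => [|i y z _ ->]; first by rewrite row_mx0.
    by rewrite /es scale_row_mx scaler0 add_row_mx add0r.
  by rewrite opp_row_mx add_row_mx oppr0 add0r addr0.
move=> [y Qy]; apply/sweepsP; first exact: enum_uniq.
exists (fun i => - y 0 i); rewrite big_enum/=; congr Q : Qy.
have -> : \sum_i - y 0 i *: es i = row_mx 0 (- y).
  rewrite [in RHS](row_sum_delta y) -sumrN.
  elim/big_rec2: _ => [|i u z _ ->]; first by rewrite row_mx0.
  by rewrite /es scaleNr scale_row_mx scaler0 opp_row_mx add_row_mx oppr0 add0r.
by rewrite opp_row_mx add_row_mx oppr0 opprK addr0 add0r.
Qed.

Definition minkowski_sum d (A B : set 'rV[R]_d) : set 'rV[R]_d :=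
  [set a + b | a in A & b in B].

Lemma is_polyhedron_sum d (A B : set 'rV[R]_d) :
  is_polyhedron A -> is_polyhedron B -> is_polyhedron (minkowski_sum A B).
Proof.
move=> PA PB.
pose MA : 'M[R]_(d + d, d) := col_mx 0 1%:M.
pose MB : 'M[R]_(d + d, d) := col_mx 1%:M (- 1%:M).
have := is_polyhedron_exists (is_polyhedronI
  (is_polyhedron_preimage MA 0 PA) (is_polyhedron_preimage MB 0 PB)).
congr is_polyhedron; apply/seteqP; split => x /=.
  move=> [y []]; rewrite !mul_row_col !mulmx0 !mulmxN !mulmx1 !addr0 add0r.
  by move=> Ay Bxy; exists y => //; exists (x - y); rewrite // subrKC.
move=> [a Aa [b Bb <-]]; exists a.
rewrite !mul_row_col !mulmx0 !mulmxN !mulmx1 !addr0 add0r; split => //.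
by rewrite addrAC subrr add0r.
Qed.

Lemma is_polyhedron1 d (v : 'rV[R]_d) : is_polyhedron [set v].
Proof.
have -> : [set v] = [set x : 'rV[R]_d | forall i, dotv (delta_mx 0 i) x = v 0 i].
  have E i x : dotv (delta_mx 0 i) x = x 0 i.
    rewrite dotvE (bigD1 i)//= big1 ?addr0 ?mxE ?eqxx ?mul1r// => j ji.
    by rewrite mxE (negbTE ji) andbF mul0r.
  apply/seteqP; split => x /=; first by move=> -> i.
  by move=> H; apply/rowP => i; rewrite -H E.
by apply: is_polyhedron_bigI => i; exact: is_polyhedron_eq.
Qed.

End Polyhedra.

Section EulerCharacteristic.
Context {R : realType} {K : pzRingType}.

(* One-variable systems of inequalities c.1 * t <= c.2. *)
Let ray (s : seq (R * R)) : set R := [set t | {in s, forall c, c.1 * t <= c.2}].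
Let top (s : seq (R * R)) (u : R) := ray s u /\ forall t, ray s t -> t <= u.

Let ray_convex s u v t : ray s u -> ray s v -> u <= t -> t <= v -> ray s t.
Proof.
move=> su sv ut tv c cs; have := su c cs; have := sv c cs.
have [c0|c0] := leP 0 c.1 => hv hu.
  by apply: le_trans hv; rewrite ler_wpM2l.
by apply: le_trans hu; rewrite ler_nM2l.
Qed.

Let ray_right s u : \forall t \near u^'+,
  ((u \in ray s)%:R - (t \in ray s)%:R = (`[< top s u >])%:R :> K).
Proof.
have [su|su] := pselect (ray s u); last first.
  have [c [cs cu]] : exists c, c \in s /\ c.2 < c.1 * u.
    apply: contrapT => H; apply: su => c cs.
    by rewrite leNgt; apply/negP => cu; apply: H; exists c.
  have -> : `[< top s u >] = false by apply/asboolF => -[].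
  have -> : (u \in ray s) = false by exact: memNset.
  suff : \forall t \near u^'+, ~ ray s t.
    by apply: filterS => t st; rewrite memNset// subr0.
  have [c0|c0] := leP 0 c.1.
    near=> t => /(_ c cs); apply/negP; rewrite -ltNge (lt_le_trans cu)//.
    by rewrite ler_wpM2l.
  near=> t => /(_ c cs); apply/negP; rewrite -ltNge -ltr_ndivlMl//.
  near: t; apply: nbhs_right_lt.
  by rewrite ltr_ndivlMl.
have [Tu|Tu] := pselect (top s u).
  rewrite asboolT//; near=> t.
  rewrite (mem_set su) memNset ?subr0// => /Tu.2; apply/negP; rewrite -ltNge.
  by near: t; exact: nbhs_right_gt.
rewrite asboolF//.
have [v [sv uv]] : exists v, ray s v /\ u < v.
  apply: contrapT => H; apply: Tu; split=> // t st.
  by rewrite leNgt; apply/negP => cu; apply: H; exists t.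
near=> t; rewrite !mem_set ?subrr//; apply: (ray_convex su sv) => //.
by near: t; exact: nbhs_right_le.
Unshelve. all: by end_near. Qed.

Let ray_pinfty s : \forall t \near +oo,
  (t \in ray s)%:R =
  (`[< ray s !=set0 >])%:R - (`[< exists u, top s u >])%:R :> K.
Proof.
have [[t0 s0]|se] := pselect (ray s !=set0); last first.
  rewrite !asboolF => [|[u [su _]]|]//; last by apply: se; exists u.
  by near=> t; rewrite memNset ?subrr// => st; apply: se; exists t.
have s0' : ray s !=set0 by exists t0.
rewrite [`[< ray s !=set0 >]]asboolT//.
have [[u Tu]|Ts] := pselect (exists u, top s u).
  rewrite asboolT; last by exists u.
  near=> t; rewrite memNset ?subrr// => /Tu.2; apply/negP; rewrite -ltNge.
  by near: t; apply: nbhs_pinfty_gt; rewrite num_real.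
rewrite asboolF// subr0.
suff H : {in s, forall c, c.1 <= 0}.
  near=> t; have t0t : t0 <= t.
    by near: t; apply: nbhs_pinfty_ge; rewrite num_real.
  rewrite mem_set// => c cs; apply: le_trans (s0 c cs).
  by rewrite ler_wnM2l ?H.
move=> c cs; rewrite leNgt; apply/negP => c0; apply: Ts.
have ub : ubound (ray s) (c.2 / c.1).
  by move=> t /(_ c cs); rewrite ler_pdivlMr// mulrC.
have hs : has_sup (ray s) by split => //; exists (c.2 / c.1).
have sub t : ray s t -> t <= sup (ray s) by move=> st; exact: (sup_upper_bound hs).
exists (sup (ray s)); split => // b bs.
have [b0|b0] := leP b.1 0.
  by apply: le_trans (s0 b bs); rewrite ler_wnM2l ?sub.
rewrite mulrC -ler_pdivlMr//; apply: ge_sup => // t /(_ b bs).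
by rewrite ler_pdivlMr// mulrC.
Unshelve. all: by end_near. Qed.

Let ray_euler (I : finType) (a : I -> K) (s : I -> seq (R * R)) :
  (forall t, \sum_i a i * (t \in ray (s i))%:R = 0) ->
  \sum_i a i * (`[< ray (s i) !=set0 >])%:R = 0.
Proof.
move=> H.
have Hu u : \sum_i a i * (`[< top (s i) u >])%:R = 0.
  have N : \forall t \near u^'+, forall i,
      ((u \in ray (s i))%:R - (t \in ray (s i))%:R
        = (`[< top (s i) u >])%:R :> K).
    by apply: filter_forall => i; exact: ray_right.
  have [t Ht] := @filter_ex _ _ (at_right_proper_filter u) _ N.
  under eq_bigr do rewrite -Ht mulrBr.
  by rewrite sumrB !H subrr.
have N : \forall t \near +oo, forall i, (t \in ray (s i))%:R =
    (`[< ray (s i) !=set0 >])%:R - (`[< exists u, top (s i) u >])%:R :> K.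
  by apply: filter_forall => i; exact: ray_pinfty.
have [t Ht] := @filter_ex _ _ proper_pinfty_nbhs _ N.
have := H t; under eq_bigr do rewrite Ht mulrBr.
rewrite sumrB => /eqP; rewrite subr_eq0 => /eqP ->.
pose g i := xget 0 (top (s i)).
have gP i u : top (s i) u -> u = g i.
  move=> Tu; have Tg : top (s i) (g i) by apply: xgetPex; exists u.
  by apply/le_anti; rewrite (Tu.2 _ Tg.1) (Tg.2 _ Tu.1).
pose U := undup [seq g i | i <- enum I].
have E i : (`[< exists u, top (s i) u >])%:R =
    \sum_(u <- U) (`[< top (s i) u >])%:R :> K.
  rewrite (bigD1_seq (g i)) ?undup_uniq ?mem_undup ?map_f ?mem_enum//=; last first.
    by rewrite -enumT mem_enum.
  rewrite big1 ?addr0 => [|u ug].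
    by congr ((nat_of_bool _)%:R); apply: asbool_equiv_eq; split=> [[u Tu]|]; [rewrite -(gP _ _ Tu)|exists (g i)].
  by rewrite asboolF// => /gP; exact/eqP.
under eq_bigr do rewrite E mulr_sumr.
by rewrite exchange_big big1.
Qed.

Lemma sweep_sum0 d (e : 'rV[R]_d) (I : finType) (a : I -> K) (A : I -> set 'rV[R]_d) :
  (forall i, is_polyhedron (A i)) ->
  (forall x, \sum_i a i * (x \in A i)%:R = 0) ->
  forall x, \sum_i a i * (x \in sweep e (A i))%:R = 0.
Proof.
move=> /choice[s sA] H x.
pose r i := [seq (- dotv c.1 e, c.2 - dotv c.1 x) | c <- s i].
have E i t : ray (r i) t = A i (x - t *: e).
  rewrite sA; apply/propext; split => /= h.
    move=> c cs; have /= := h _ (map_f _ cs).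
    by rewrite dotvBr dotvZr; lra.
  move=> _ /mapP[c cs ->] /=; have := h c cs.
  by rewrite dotvBr dotvZr; lra.
have Em i t : (t \in ray (r i)) = (x - t *: e \in A i).
  by apply/idP/idP; rewrite !inE E.
rewrite -[RHS](@ray_euler I a r) => [|t]; last first.
  by under eq_bigr do rewrite Em; exact: H.
apply: eq_bigr => i _; congr (_ * (nat_of_bool _)%:R).
apply: asbool_equiv_eq; split=> -[t]; first by rewrite -E; exists t.
by rewrite E => At; exists t.
Qed.

(* Euler characteristic: a linear relation between indicator functions of
   closed convex polyhedra is preserved when each nonempty polyhedron is
   replaced by 1. *)
Lemma euler_sum0 d (I : finType) (a : I -> K) (A : I -> set 'rV[R]_d) :
  (forall i, is_polyhedron (A i)) ->
  (forall x, \sum_i a i * (x \in A i)%:R = 0) ->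
  \sum_i a i * (`[< A i !=set0 >])%:R = 0.
Proof.
move=> PA H.
pose es : seq 'rV[R]_d := [seq delta_mx 0 j | j <- enum 'I_d].
have Hs (l : seq 'rV[R]_d) x : \sum_i a i * (x \in sweeps l (A i))%:R = 0.
  elim: l x => [|e l IH] //= x; apply: sweep_sum0 => // i.
  exact: is_polyhedron_sweeps.
rewrite -[RHS](Hs es 0); apply: eq_bigr => i _; congr (_ * (nat_of_bool _)%:R).
apply: asbool_equiv_eq; split.
  move=> [y Ay]; apply/sweepsP; first exact: enum_uniq.
  exists (fun j => - y 0 j); rewrite big_enum/= sub0r -sumrN; congr (A i) : Ay.
  by rewrite {1}[y]row_sum_delta; apply: eq_bigr => j _; rewrite scaleNr opprK.
by move=> /sweepsP[|t At]; [exact: enum_uniq|eexists; exact: At].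
Qed.

Lemma minkowski_sum0 d (I : finType) (a : I -> K) (A : I -> set 'rV[R]_d) B :
  (forall i, is_polyhedron (A i)) -> is_polyhedron B ->
  (forall x, \sum_i a i * (x \in A i)%:R = 0) ->
  forall x, \sum_i a i * (x \in minkowski_sum (A i) B)%:R = 0.
Proof.
move=> PA PB H x.
pose D : set 'rV[R]_d := [set y | B (y *m (- 1%:M) + x)].
have PD : is_polyhedron D by exact: is_polyhedron_preimage.
have DE y : D y = B (x - y) by rewrite /D/= mulmxN mulmx1 addrC.
rewrite -[RHS](@euler_sum0 d I a (fun i => A i `&` D)).
- apply: eq_bigr => i _; congr (_ * (nat_of_bool _)%:R).
  apply: asbool_equiv_eq; split.
    by move=> [y Ay [z Bz zx]]; exists y; split; rewrite // DE -zx addrAC subrr add0r.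
  by move=> [y [Ay]]; rewrite DE => By; exists y => //; exists (x - y); rewrite // subrKC.
- by move=> i; exact: is_polyhedronI.
move=> y; under eq_bigr do rewrite in_setI -mulnb natrM mulrA.
by rewrite -mulr_suml H mul0r.
Qed.

End EulerCharacteristic.

Section MinkowskiRing.
Variables (R : realType) (d : nat).
Local Notation W := 'rV[R]_d.
Implicit Types (f g h : W -> R[i]^o) (A B : set W).

Definition indicator_comb (I : finType) (a : I -> R[i]) (A : I -> set W) :
  W -> R[i]^o := fun x => \sum_i a i * \1_(A i) x.

Definition is_rep f (I : finType) (a : I -> R[i]) (A : I -> set W) : Prop :=
  (forall i, is_polyhedron (A i)) /\ f = indicator_comb a A.

Definition polyhedral_fun : {pred W -> R[i]^o} :=
  [pred f | `[< exists (I : finType) (a : I -> R[i]) (A : I -> set W),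
                is_rep f a A >]].

Lemma polyhedral_funP f : reflect
  (exists (I : finType) (a : I -> R[i]) (A : I -> set W), is_rep f a A)
  (f \in polyhedral_fun).
Proof. exact: asboolP. Qed.

Lemma is_rep0 : is_rep 0 (fun i : void => 0) (fun i : void => set0).
Proof.
by split=> [[]|]; apply/funext => x; rewrite /indicator_comb big1// => -[].
Qed.

Definition join_fun T (I J : finType) (a : I -> T) (b : J -> T) (k : I + J) :=
  match k with inl i => a i | inr j => b j end.

Lemma indicator_combD (I J : finType) (a : I -> R[i]) (b : J -> R[i])
    (A : I -> set W) (B : J -> set W) :
  indicator_comb (join_fun a b) (join_fun A B) =
  indicator_comb a A + indicator_comb b B.
Proof.
by apply/funext => x; rewrite /indicator_comb big_sumType.
Qed.

Lemma indicator_combZ (I : finType) (c : R[i]) (a : I -> R[i])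
    (A : I -> set W) :
  indicator_comb (fun i => c * a i) A = c *: indicator_comb a A.
Proof.
apply/funext => x; rewrite /indicator_comb [RHS]mulr_sumr.
by apply: eq_bigr => i _; rewrite mulrA.
Qed.

Lemma is_repD f g (I J : finType) (a : I -> R[i]) (b : J -> R[i])
    (A : I -> set W) (B : J -> set W) :
  is_rep f a A -> is_rep g b B ->
  is_rep (f + g) (join_fun a b) (join_fun A B).
Proof.
move=> [PA ->] [PB ->]; split; first by case.
by rewrite indicator_combD.
Qed.

Lemma is_repZ c f (I : finType) (a : I -> R[i]) (A : I -> set W) :
  is_rep f a A -> is_rep (c *: f) (fun i => c * a i) A.
Proof. by move=> [PA ->]; split; rewrite ?indicator_combZ. Qed.

Lemma is_rep1 A : is_polyhedron A ->
  is_rep \1_A (fun _ : unit => 1) (fun _ : unit => A).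
Proof.
move=> PA; split => //; apply/funext => x.
by rewrite /indicator_comb big_const card_unit/= mul1r addr0.
Qed.

Lemma polyhedral_fun_closed : submod_closed polyhedral_fun.
Proof.
split=> [|c f g]; first by apply/polyhedral_funP; do 3 eexists; exact: is_rep0.
move=> /polyhedral_funP[I [a [A rf]]] /polyhedral_funP[J [b [B rg]]].
by apply/polyhedral_funP; do 3 eexists; exact: is_repD (is_repZ c rf) rg.
Qed.

HB.instance Definition _ :=
  GRing.isSubmodClosed.Build R[i] (W -> R[i]^o) polyhedral_fun
    (GRing.submod_closed_semi polyhedral_fun_closed).

Lemma indic_polyhedral A : is_polyhedron A -> \1_A \in polyhedral_fun.
Proof.
by move=> PA; apply/polyhedral_funP; do 3 eexists; exact: is_rep1.
Qed.

(* The product of two combinations of indicator functions of polyhedra,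
   obtained by extending [A] . [B] = [A + B] bilinearly. *)
Definition minkowski_comb (I J : finType) (a : I -> R[i]) (b : J -> R[i])
    (A : I -> set W) (B : J -> set W) : W -> R[i]^o :=
  indicator_comb (fun k : I * J => a k.1 * b k.2)
                 (fun k : I * J => minkowski_sum (A k.1) (B k.2)).

Lemma minkowski_sumC A B : minkowski_sum A B = minkowski_sum B A.
Proof.
by apply/seteqP; split => _ [x Ax [y By <-]];
  exists y => //; exists x => //; rewrite addrC.
Qed.

Lemma minkowski_sumA A B C : minkowski_sum A (minkowski_sum B C) =
  minkowski_sum (minkowski_sum A B) C.
Proof.
apply/seteqP; split => [_ [x Ax [_ [y By [z Cz <-]] <-]]|].
  by exists (x + y); [exists x => //; exists y|exists z => //; rewrite addrA].
move=> _ [_ [x Ax [y By <-]] [z Cz <-]].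
by exists x => //; exists (y + z); [exists y => //; exists z|rewrite addrA].
Qed.

Lemma minkowski_sum0s A : minkowski_sum [set 0] A = A.
Proof.
apply/seteqP; split => [_ [_ -> [y Ay <-]]|y Ay]; first by rewrite add0r.
by exists 0 => //; exists y => //; rewrite add0r.
Qed.

Lemma minkowski_combC (I J : finType) (a : I -> R[i]) (b : J -> R[i])
    (A : I -> set W) (B : J -> set W) :
  minkowski_comb a b A B = minkowski_comb b a B A.
Proof.
apply/funext => x; rewrite /minkowski_comb /indicator_comb.
rewrite -(pair_bigA _ (fun i j => (a i * b j) * \1_(minkowski_sum (A i) (B j)) x)).
rewrite -(pair_bigA _ (fun j i => (b j * a i) * \1_(minkowski_sum (B j) (A i)) x)).
rewrite exchange_big; apply: eq_bigr => j _; apply: eq_bigr => i _.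
by rewrite minkowski_sumC [a i * _]mulrC.
Qed.

Lemma minkowski_comb_indepl f (I I' J : finType) (a : I -> R[i])
    (a' : I' -> R[i]) (b : J -> R[i])
    (A : I -> set W) (A' : I' -> set W) (B : J -> set W) :
  is_rep f a A -> is_rep f a' A' -> (forall j, is_polyhedron (B j)) ->
  minkowski_comb a b A B = minkowski_comb a' b A' B.
Proof.
move=> [PA fE] [PA' fE'] PB; apply/funext => x.
have H j : \sum_i a i * (x \in minkowski_sum (A i) (B j))%:R =
           \sum_i a' i * (x \in minkowski_sum (A' i) (B j))%:R.
  apply/eqP; rewrite -subr_eq0 -sumrN; apply/eqP.
  have P k : is_polyhedron (join_fun A A' k) by case: k.
  have := minkowski_sum0 (a := join_fun a (fun i => - a' i)) P (PB j) _ x.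
  rewrite big_sumType/=; under [in X in _ + X]eq_bigr do rewrite mulNr.
  apply=> y; rewrite big_sumType/=.
  under [in X in _ + X]eq_bigr do rewrite mulNr.
  have E : indicator_comb a A y = indicator_comb a' A' y by rewrite -fE fE'.
  by apply/eqP; rewrite sumrN subr_eq0; apply/eqP; exact: E.
rewrite /minkowski_comb /indicator_comb.
rewrite -(pair_bigA _ (fun i j => (a i * b j) * \1_(minkowski_sum (A i) (B j)) x)).
rewrite -(pair_bigA _ (fun i j => (a' i * b j) * \1_(minkowski_sum (A' i) (B j)) x)).
rewrite exchange_big [RHS]exchange_big/=; apply: eq_bigr => j _.
under eq_bigr do rewrite mulrAC.
under [RHS]eq_bigr do rewrite mulrAC.
by rewrite -!mulr_suml H.
Qed.

(* The product does not depend on the chosen representations. *)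
Lemma minkowski_comb_indep f g (I I' J J' : finType) (a : I -> R[i])
    (a' : I' -> R[i]) (b : J -> R[i]) (b' : J' -> R[i])
    (A : I -> set W) (A' : I' -> set W) (B : J -> set W) (B' : J' -> set W) :
  is_rep f a A -> is_rep f a' A' -> is_rep g b B -> is_rep g b' B' ->
  minkowski_comb a b A B = minkowski_comb a' b' A' B'.
Proof.
move=> fA fA' gB gB'; rewrite (minkowski_comb_indepl b fA fA' gB.1).
rewrite minkowski_combC (minkowski_comb_indepl a' gB gB' fA'.1).
by rewrite minkowski_combC.
Qed.

(* The functions W -> C spanned by indicator functions of polyhedra; the
   product declared below is minkowski_mul, not the pointwise product. *)
Record minkowski_ring := MinkowskiRing {
  fun_of_minkowski :> W -> R[i]^o;
  _ : fun_of_minkowski \in polyhedral_fun }.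

HB.instance Definition _ := [isSub for fun_of_minkowski].
HB.instance Definition _ := [Choice of minkowski_ring by <:].
HB.instance Definition _ :=
  [SubChoice_isSubLmodule of minkowski_ring by <:].

Implicit Types u v w : minkowski_ring.

Lemma minkowski_rep u :
  exists (I : finType) (a : I -> R[i]) (A : I -> set W), is_rep u a A.
Proof. exact/polyhedral_funP/valP. Qed.

Lemma is_repM f g (I J : finType) (a : I -> R[i]) (b : J -> R[i])
    (A : I -> set W) (B : J -> set W) :
  is_rep f a A -> is_rep g b B ->
  is_rep (minkowski_comb a b A B) (fun k : I * J => a k.1 * b k.2)
         (fun k : I * J => minkowski_sum (A k.1) (B k.2)).
Proof. by move=> [PA _] [PB _]; split => // k; exact: is_polyhedron_sum. Qed.

Lemma minkowski_mul_subproof u v : exists w,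
  forall (I J : finType) (a : I -> R[i]) (b : J -> R[i])
    (A : I -> set W) (B : J -> set W), is_rep u a A -> is_rep v b B ->
  w = minkowski_comb a b A B :> (W -> R[i]^o).
Proof.
have [I [a [A rA]]] := minkowski_rep u.
have [J [b [B rB]]] := minkowski_rep v.
have Hw : minkowski_comb a b A B \in polyhedral_fun.
  by apply/polyhedral_funP; do 3 eexists; exact: is_repM rA rB.
exists (MinkowskiRing Hw) => I' J' a' b' A' B' rA' rB' /=.
exact: minkowski_comb_indep rA rA' rB rB'.
Qed.

(* Characterized by minkowski_mulE, and by minkowski_indicM on indicators. *)
Definition minkowski_mul u v : minkowski_ring :=
  projT1 (cid (minkowski_mul_subproof u v)).

Lemma minkowski_mulE u v (I J : finType) (a : I -> R[i]) (b : J -> R[i])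
    (A : I -> set W) (B : J -> set W) : is_rep u a A -> is_rep v b B ->
  minkowski_mul u v = minkowski_comb a b A B :> (W -> R[i]^o).
Proof. by rewrite /minkowski_mul; case: cid => w /= H; exact: H. Qed.

Lemma minkowski_mul_rep u v (I J : finType) (a : I -> R[i]) (b : J -> R[i])
    (A : I -> set W) (B : J -> set W) : is_rep u a A -> is_rep v b B ->
  is_rep (minkowski_mul u v) (fun k : I * J => a k.1 * b k.2)
         (fun k : I * J => minkowski_sum (A k.1) (B k.2)).
Proof.
by move=> rA rB; rewrite (minkowski_mulE rA rB); exact: is_repM rA rB.
Qed.

(* [A]; this is 0 when A is not a polyhedron. *)
Definition minkowski_indic A : minkowski_ring := insubd 0 (\1_A : W -> R[i]^o).

Lemma minkowski_indicE A : is_polyhedron A ->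
  minkowski_indic A = \1_A :> (W -> R[i]^o).
Proof. by move=> PA; rewrite insubdK//; exact: indic_polyhedral. Qed.

Lemma minkowski_indic_rep A : is_polyhedron A ->
  is_rep (minkowski_indic A) (fun _ : unit => 1) (fun _ : unit => A).
Proof. by move=> PA; rewrite minkowski_indicE//; exact: is_rep1. Qed.

Let minkowski_mulA : associative minkowski_mul.
Proof.
move=> u v w; apply/val_inj => /=.
have [I [a [A rA]]] := minkowski_rep u.
have [J [b [B rB]]] := minkowski_rep v.
have [K [c [C rC]]] := minkowski_rep w.
rewrite (minkowski_mulE rA (minkowski_mul_rep rB rC)).
rewrite (minkowski_mulE (minkowski_mul_rep rA rB) rC).
apply/funext => x; rewrite /minkowski_comb /indicator_comb.
rewrite (reindex (fun p : I * J * K => (p.1.1, (p.1.2, p.2)))) /=; last first.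
  by exists (fun q => ((q.1, q.2.1), q.2.2)) => [[[? ?] ?]|[? [? ?]]].
by apply: eq_bigr => -[[i j] k] _ /=; rewrite minkowski_sumA mulrA.
Qed.

Let minkowski_mulC : commutative minkowski_mul.
Proof.
move=> u v; apply/val_inj => /=.
have [I [a [A rA]]] := minkowski_rep u.
have [J [b [B rB]]] := minkowski_rep v.
by rewrite (minkowski_mulE rA rB) (minkowski_mulE rB rA) minkowski_combC.
Qed.

Let minkowski_mul1 : left_id (minkowski_indic [set 0]) minkowski_mul.
Proof.
move=> u; apply/val_inj => /=.
have [I [a [A rA]]] := minkowski_rep u.
rewrite (minkowski_mulE (minkowski_indic_rep (is_polyhedron1 0)) rA).
rewrite [in RHS]rA.2; apply/funext => x.
rewrite /minkowski_comb /indicator_comb.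
rewrite (reindex (fun i : I => (tt, i))) /=; last first.
  by exists snd => // -[[] i].
by apply: eq_bigr => i _; rewrite mul1r minkowski_sum0s.
Qed.

Let minkowski_mulDl : left_distributive minkowski_mul +%R.
Proof.
move=> u v w; apply/val_inj => /=.
have [I [a [A rA]]] := minkowski_rep u.
have [J [b [B rB]]] := minkowski_rep v.
have [K [c [C rC]]] := minkowski_rep w.
have rAB : is_rep (u + v) _ _ := is_repD rA rB.
rewrite (minkowski_mulE rAB rC) (minkowski_mulE rA rC) (minkowski_mulE rB rC).
apply/funext => x; rewrite /minkowski_comb [RHS]/GRing.add/= /indicator_comb.
rewrite -(pair_bigA _ (fun i j => (join_fun a b i * c j) *
   \1_(minkowski_sum (join_fun A B i) (C j)) x)) big_sumType/=.
by rewrite !pair_bigA.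
Qed.

Let minkowski_1neq0 : minkowski_indic [set 0] != 0.
Proof.
apply/eqP => /(congr1 (fun u : minkowski_ring => u 0)).
rewrite minkowski_indicE ?indicE ?mem_set//; last exact: is_polyhedron1.
by move/eqP; rewrite oner_eq0.
Qed.

HB.instance Definition _ := GRing.Zmodule_isComNzRing.Build minkowski_ring
  minkowski_mulA minkowski_mulC minkowski_mul1 minkowski_mulDl minkowski_1neq0.

Let minkowski_scaleAl (c : R[i]) u v : c *: (u * v) = (c *: u) * v.
Proof.
apply/val_inj => /=.
have [I [a [A rA]]] := minkowski_rep u.
have [J [b [B rB]]] := minkowski_rep v.
have rcA : is_rep (c *: u) _ _ := is_repZ c rA.
rewrite (minkowski_mulE rA rB) (minkowski_mulE rcA rB).
rewrite -indicator_combZ; apply/funext => x.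
by apply: eq_bigr => i _; rewrite mulrA.
Qed.

HB.instance Definition _ :=
  GRing.Lmodule_isLalgebra.Build R[i] minkowski_ring minkowski_scaleAl.
HB.instance Definition _ :=
  GRing.Lalgebra_isComAlgebra.Build R[i] minkowski_ring.

Lemma minkowski_indicM A B : is_polyhedron A -> is_polyhedron B ->
  minkowski_indic A * minkowski_indic B = minkowski_indic (minkowski_sum A B).
Proof.
move=> PA PB; apply/val_inj.
rewrite /= (minkowski_mulE (minkowski_indic_rep PA) (minkowski_indic_rep PB)).
rewrite minkowski_indicE; last exact: is_polyhedron_sum.
apply/funext => x; rewrite /minkowski_comb /indicator_comb.
rewrite (reindex (fun _ : unit => (tt, tt))) /=; last first.
  by exists (fun=> tt) => [[]|[[] []]].
by rewrite big_const card_unit/= addr0 !mul1r.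
Qed.

Lemma minkowski_indic1 : minkowski_indic [set 0] = 1.
Proof. by []. Qed.

End MinkowskiRing.

Section Polytopes.
Variables (R : realType) (d : nat).
Local Notation W := 'rV[R]_d.
Implicit Types (P F : set W).

Definition convex_hull (n : nat) (p : 'I_n -> W) : set W :=
  [set x | exists l : 'I_n -> R,
    [/\ forall i, 0 <= l i, \sum_i l i = 1 & x = \sum_i l i *: p i]].

Definition is_polytope P : Prop :=
  exists (n : nat) (p : 'I_n -> W), P = convex_hull p.

Definition affine_hull P : set W :=
  [set x | exists (n : nat) (p : 'I_n -> W) (l : 'I_n -> R),
    [/\ forall i, P (p i), \sum_i l i = 1 & x = \sum_i l i *: p i]].

Definition has_dim P (k : nat) : Prop :=
  exists (x : W) (U : {vspace W}),
    affine_hull P = [set x + u | u in [set u | u \in U]] /\ \dim U = k.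

Definition is_dpolytope P : Prop := is_polytope P /\ has_dim P d.

(* The nonempty faces of P are its intersections with supporting hyperplanes,
   and P itself (take a = 0 and b = 0). *)
Definition is_face P F : Prop :=
  F !=set0 /\ exists (a : W) (b : R),
    (forall x, P x -> dotv a x <= b) /\ F = P `&` [set x | dotv a x = b].

Definition is_vertex P (v : W) : Prop := is_face P [set v].

Lemma is_polytope_polyhedron P : is_polytope P -> is_polyhedron P.
Proof.
move=> [n [p ->]].
pose M : 'M[R]_(n, d) := \matrix_i p i.
pose Q : set 'rV[R]_(d + n) :=
  [set z | (forall i, dotv (row_mx 0 (- delta_mx 0 i)) z <= 0) /\
    (dotv (row_mx 0 (const_mx 1)) z = 1 /\
     [set 0 : W] (z *m col_mx 1%:M (- M) + 0))].
have PQ : is_polyhedron Q.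
  apply: is_polyhedronI.
    by apply: is_polyhedron_bigI => i; exact: is_polyhedron_le.
  apply: is_polyhedronI; first exact: is_polyhedron_eq.
  by apply: is_polyhedron_preimage; exact: is_polyhedron1.
have := is_polyhedron_exists PQ; congr is_polyhedron.
have D (a y : 'rV[R]_n) (x : W) : dotv (row_mx 0 a) (row_mx x y) = dotv a y.
  by rewrite /dotv tr_row_mx mul_row_col mul0mx add0r.
have Di i (y : 'rV[R]_n) : dotv (- delta_mx 0 i) y = - y 0 i.
  rewrite dotvNl dotvE (bigD1 i)//= big1 ?addr0 => [|j ji].
    by rewrite mxE !eqxx mul1r.
  by rewrite mxE (negbTE ji) andbF mul0r.
have D1 (y : 'rV[R]_n) : dotv (const_mx 1) y = \sum_i y 0 i.
  by rewrite dotvE; apply: eq_bigr => i _; rewrite mxE mul1r.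
have DM (x : W) (y : 'rV[R]_n) :
    row_mx x y *m col_mx 1%:M (- M) + 0 = x - \sum_i y 0 i *: p i.
  rewrite addr0 mul_row_col mulmx1 mulmxN mulmx_sum_row.
  by congr (_ - _); apply: eq_bigr => i _; rewrite rowK.
apply/seteqP; split => x /=.
  move=> [y [y0 [y1 /eqP]]]; rewrite DM subr_eq0 => /eqP xE.
  exists (fun i => y 0 i); split => //; last by rewrite -D1 -(D _ _ x).
  by move=> i; have := y0 i; rewrite D Di oppr_le0.
move=> [l [l0 l1 xE]]; exists (\row_i l i); split.
  by move=> i; rewrite D Di mxE oppr_le0.
rewrite D D1 DM; split.
  by rewrite -l1; apply: eq_bigr => i _; rewrite mxE.
by apply/eqP; rewrite subr_eq0 xE; apply/eqP/eq_bigr => i _; rewrite mxE.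
Qed.

Lemma is_face_polyhedron P F : is_polytope P -> is_face P F -> is_polyhedron F.
Proof.
move=> /is_polytope_polyhedron PP [_ [a [b [_ ->]]]].
by apply: is_polyhedronI => //; exact: is_polyhedron_eq.
Qed.

Lemma finite_faces P : is_polytope P -> finite_set (is_face P).
Proof.
move=> [n [p PE]].
have Pp i : P (p i).
  rewrite PE; exists (fun j => (j == i)%:R); split => //.
    by rewrite (bigD1 i)//= eqxx big1 ?addr0// => j /negbTE ->.
  rewrite (bigD1 i)//= eqxx scale1r big1 ?addr0// => j /negbTE ->.
  by rewrite scale0r.
pose vs F : {set 'I_n} := [set i | p i \in F]%SET.
suff H F G : is_face P F -> is_face P G -> (vs F \subset vs G) -> F `<=` G.
  pose g (S : {set 'I_n}) := xget set0 [set F | is_face P F /\ vs F = S].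
  apply: (sub_finite_set _ (@finite_image _ _ setT g finite_finset)).
  move=> F PF; exists (vs F) => //.
  have [Pg ge] : is_face P (g (vs F)) /\ vs (g (vs F)) = vs F.
    by rewrite /g; case: xgetP => [G -> //|/(_ F)[]].
  by apply/seteqP; split; apply: H => //; rewrite ge subxx.
move=> [_ [a [b [ab ->]]]] [_ [a' [b' [_ ->]]]] /fintype.subsetP sub x [Px /= xb].
split => //=; move: (Px); rewrite PE => -[l [l0 l1 xE]].
have E i : l i * (b - dotv a (p i)) = 0.
  have : \sum_i l i * (b - dotv a (p i)) == 0.
    under eq_bigr do rewrite mulrBr.
    by rewrite sumrB -mulr_suml l1 mul1r -dotv_sumr -xE xb subrr.
  rewrite psumr_eq0 => [/allP/(_ i)|j _]; last first.
    by rewrite mulr_ge0// subr_ge0 ab.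
  by rewrite mem_index_enum => /(_ isT)/eqP.
rewrite xE dotv_sumr -[RHS]mul1r -l1 mulr_suml; apply: eq_bigr => i _.
have /eqP := E i; rewrite mulf_eq0 => /orP[/eqP ->|]; first by rewrite !mul0r.
rewrite subr_eq0 => /eqP bE; congr (_ * _).
have /sub : i \in vs (P `&` [set x | dotv a x = b]).
  by rewrite inE; apply/mem_set; split.
by rewrite inE => /set_mem[].
Qed.

End Polytopes.

Section FaceRing.
Variables (R : realType) (d : nat) (P : set 'rV[R]_d).
Local Notation M := (minkowski_ring R d).

(* The smallest unital subalgebra containing the [F], F a nonempty face. *)
Definition face_subalgebra : {pred M} :=
  [pred u | `[< forall S : {pred M}, subalg_closed S ->
    (forall F, is_face P F -> minkowski_indic F \in S) -> u \in S >]].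

Lemma face_subalgebra_closed : subalg_closed face_subalgebra.
Proof.
split=> [|c u v /asboolP uS /asboolP vS|u v /asboolP uS /asboolP vS];
  apply/asboolP => S cS FS; have [S1 SL SM] := cS.
- exact: S1.
- by apply: SL; [exact: uS|exact: vS].
- by apply: SM; [exact: uS|exact: vS].
Qed.

HB.instance Definition _ := GRing.isSubalgClosed.Build R[i] M face_subalgebra
  (GRing.subalg_closed_semi face_subalgebra_closed).

Record face_ring := FaceRing {
  minkowski_of_face_ring :> M;
  _ : minkowski_of_face_ring \in face_subalgebra }.

HB.instance Definition _ := [isSub for minkowski_of_face_ring].
HB.instance Definition _ := [Choice of face_ring by <:].
HB.instance Definition _ := [SubChoice_isSubAlgebra of face_ring by <:].
HB.instance Definition _ := [SubNzRing_isSubComNzRing of face_ring by <:].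

(* [F] as an element of the face ring; this is 0 when [F] is not in it. *)
Definition face_indic (F : set 'rV[R]_d) : face_ring :=
  insubd 0 (minkowski_indic F).

Lemma face_indicE F : is_face P F ->
  face_indic F = minkowski_indic F :> M.
Proof. by move=> PF; rewrite insubdK//; apply/asboolP => S _; exact. Qed.

End FaceRing.

(* Main.v *)
(* Expanding the product gives the sum of (-1)^|S| [Q_S] over S included in C,
   where Q_S is the Minkowski sum of the F in S and of |C| - |S| copies of P.

   If a vertex v is uncovered, every face F in C lies strictly below v for a
   functional exposing v, so that |C| v belongs to Q_S only for S empty and the
   product does not vanish at |C| v.

   Conversely, a combination of indicator functions of polytopes vanishes as
   soon as, for every u, the formal combination of their support values at u
   vanishes. Given u, some vertex of P maximizes u and lies in some F in C;
   adding or removing this F in S preserves the support value of Q_S at u and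
   changes the sign. *)
Require Import Defs.
From mathcomp Require Import all_boot all_order all_algebra.
From mathcomp Require Import complex.
From mathcomp Require Import all_classical all_reals all_analysis.
From mathcomp Require Import lra.
Import Order.TTheory GRing.Theory Num.Theory.
Local Open Scope classical_set_scope.
Local Open Scope ring_scope.

Set Implicit Arguments.
Unset Strict Implicit.
Unset Printing Implicit Defensive.

(** * Linear functionals on convex hulls; vertices and faces of polytopes *)

Section ConvexCombinations.
Variables (R : realType) (d : nat).
Local Notation W := 'rV[R]_d.
Implicit Types (P F Q : set W) (u v x : W).

Lemma dotvC u v : dotv u v = dotv v u.
Proof. by rewrite !dotvE; apply: eq_bigr => i _; rewrite mulrC. Qed.

Lemma dotv_sum u (I : finType) (y : I -> W) :
  dotv u (\sum_i y i) = \sum_i dotv u (y i).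
Proof.
elim/big_rec2: _ => [|i a x _ <-]; last by rewrite dotvDr.
by rewrite dotvC dotv0l.
Qed.

Lemma dotvv_ge0 u : 0 <= dotv u u.
Proof. by rewrite dotvE sumr_ge0// => i _; rewrite -expr2 sqr_ge0. Qed.

Lemma dotvv_eq0 u : (dotv u u == 0) = (u == 0).
Proof.
apply/eqP/eqP => [|->]; last by rewrite dotv0l.
rewrite dotvE => /eqP; rewrite psumr_eq0 => [/allP H|i _]; last first.
  by rewrite -expr2 sqr_ge0.
apply/rowP => i; rewrite mxE; apply/eqP.
by have := H i (mem_index_enum i); rewrite mulf_eq0 orbb.
Qed.

Lemma mem_convex_hull n (p : 'I_n -> W) i : convex_hull p (p i).
Proof.
exists (fun j => (j == i)%:R); split => //.
  by rewrite (bigD1 i)//= eqxx big1 ?addr0// => j /negbTE ->.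
rewrite (bigD1 i)//= eqxx scale1r big1 ?addr0// => j /negbTE ->.
by rewrite scale0r.
Qed.

(** The terms [l j * (b - dotv u (p j))] are nonnegative with sum at most 0, so each one
    vanishes. *)
Lemma convex_comb_eq n (l : 'I_n -> R) (p : 'I_n -> W) u b :
  (forall i, 0 <= l i) -> \sum_i l i = 1 ->
  (forall i, 0 < l i -> dotv u (p i) <= b) ->
  b <= dotv u (\sum_i l i *: p i) ->
  forall i, 0 < l i -> dotv u (p i) = b.
Proof.
move=> l0 l1 pb bx i li.
have t0 j : 0 <= l j * (b - dotv u (p j)).
  have [lj|] := ltP 0 (l j); first by rewrite mulr_ge0// subr_ge0 pb.
  by move=> lj; rewrite (_ : l j = 0) ?mul0r//; apply/eqP; rewrite eq_le lj l0.
have : \sum_j l j * (b - dotv u (p j)) == 0.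
  rewrite eq_le sumr_ge0// andbT.
  under eq_bigr do rewrite mulrBr.
  by rewrite sumrB -mulr_suml l1 mul1r -dotv_sumr subr_le0.
rewrite psumr_eq0 => [/allP/(_ i (mem_index_enum i))|//].
by rewrite mulf_eq0 gt_eqF//= subr_eq0 => /eqP ->.
Qed.

Lemma convex_comb_le n (l : 'I_n -> R) (p : 'I_n -> W) u b :
  (forall i, 0 <= l i) -> \sum_i l i = 1 ->
  (forall i, dotv u (p i) <= b) -> dotv u (\sum_i l i *: p i) <= b.
Proof.
move=> l0 l1 pb; rewrite dotv_sumr -[leRHS]mul1r -l1 mulr_suml.
by apply: ler_sum => i _; rewrite ler_wpM2l.
Qed.

(** An average cannot exceed all its values. Positivity of the weight lets [convex_comb_eq] place
    the generator found on a face. *)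
Lemma convex_comb_max n (l : 'I_n -> R) (p : 'I_n -> W) u :
  (forall i, 0 <= l i) -> \sum_i l i = 1 ->
  exists2 i, 0 < l i & dotv u (\sum_i l i *: p i) <= dotv u (p i).
Proof.
move=> l0 l1; apply: contrapT => H.
have lt i : 0 < l i -> dotv u (p i) < dotv u (\sum_i l i *: p i).
  by move=> li; rewrite ltNge; apply/negP => le; apply: H; exists i.
have [i li] : exists i, 0 < l i.
  apply: contrapT => N; have /eqP := l1; rewrite big1 => [|i _].
    by rewrite eq_sym oner_eq0.
  apply/eqP; rewrite eq_le l0 andbT leNgt; apply/negP => li.
  by apply: N; exists i.
have := lt i li.
by rewrite (convex_comb_eq l0 l1 (fun j lj => ltW (lt j lj)) (lexx _) li) ltxx.
Qed.

Lemma polytope_vertex_max P u : is_polytope P -> P !=set0 ->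
  exists2 v, is_vertex P v & forall x, P x -> dotv u x <= dotv u v.
Proof.
move=> [n [p PE]] [x Px].
have [i0 _] : exists2 i : 'I_n, true & true.
  move: Px; rewrite PE => -[l [l0 l1 _]].
  by have [j _ _] := convex_comb_max p 0 l0 l1; exists j.
pose i1 := [arg max_(i > i0) dotv u (p i)]%O.
have max1 j : dotv u (p j) <= dotv u (p i1).
  by rewrite /i1; case: arg_maxP => // i _ mi; exact: mi.
pose top i := dotv u (p i) == dotv u (p i1).
pose k := [arg max_(i > i1 | top i) dotv (p i) (p i)]%O.
have [topk maxk] :
    top k /\ forall j, top j -> dotv (p j) (p j) <= dotv (p k) (p k).
  by rewrite /k; case: arg_maxP => [|i ti mi]; first exact: eqxx.
pose v := p k.
have uv j : dotv u (p j) <= dotv u v by rewrite /v (eqP topk).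
(* Since [v] has maximal norm among the generators on the face exposed by [u],
   Cauchy-Schwarz shows that [v] exposes it within that face; then [N u + v]
   exposes it in [P] for [N] large. *)
have vtop j : top j -> p j != v -> dotv v (p j) < dotv v v.
  move=> tj; rewrite -subr_eq0 -dotvv_eq0 => ne.
  have : 0 < dotv (p j - v) (p j - v) by rewrite lt_def ne dotvv_ge0.
  rewrite dotvBr !(dotvC (p j - v)) !dotvBr (dotvC (p j) v).
  have := maxk j tj; rewrite -/v; lra.
have [N HN] : exists N : R, forall j, p j != v ->
    dotv (N *: u + v) (p j) < dotv (N *: u + v) v.
  (* With this [c j], the gain of [v] over [p j] along [u] outweighs the possible loss along [v];
     the [+ 1] makes it strict. Generators in [top] need no share, and the sum dominates each
     [c j]. *)
  pose c j := `|dotv v (p j - v)| / dotv u (v - p j) + 1.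
  pose c' j := if top j then 0 else c j.
  have c'0 j : 0 <= c' j.
    rewrite /c'; case: ifP => // _; rewrite addr_ge0// divr_ge0//.
    by rewrite dotvBr subr_ge0.
  exists (\sum_j c' j) => j ne; rewrite !dotvDl !dotvZl.
  have [tj|tj] := boolP (top j).
    apply: ler_ltD; last exact: vtop.
    by rewrite ler_wpM2l// sumr_ge0.
  have lt : 0 < dotv u (v - p j).
    rewrite dotvBr subr_gt0 lt_neqAle uv andbT.
    by move: tj; rewrite /top -(eqP topk).
  have : c j <= \sum_j c' j.
    by rewrite (bigD1 j)//= {1}/c' (negbTE tj) lerDl sumr_ge0.
  rewrite /c -lerBrDr ler_pdivrMr// => le.
  have := le_trans (ler_norm _) le; rewrite dotvBr mulrBl dotvBr.
  rewrite dotvBr in lt; lra.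
set w := N *: u + v in HN.
have wv j : dotv w (p j) <= dotv w v.
  by have [->//|/HN/ltW] := eqVneq (p j) v.
exists v; last first.
  by move=> y; rewrite PE => -[l [l0 l1 ->]]; exact: convex_comb_le.
split; first by exists v.
exists w, (dotv w v); split.
  by move=> y; rewrite PE => -[l [l0 l1 ->]]; exact: convex_comb_le.
apply/seteqP; split => [_ ->|y [+ /= yv]].
  by split => //; rewrite PE; exact: mem_convex_hull.
rewrite PE => -[l [l0 l1 yE]]; rewrite yE.
(* A generator of positive weight attains the maximum of [w], which only [v] does. *)
have lp i : l i *: p i = l i *: v.
  have [li|li] := ltP 0 (l i); last first.
    by rewrite (_ : l i = 0) ?scale0r//; apply/eqP; rewrite eq_le li l0.
  have [->//|/HN] := eqVneq (p i) v.
  by rewrite (convex_comb_eq l0 l1 (fun j _ => wv j) _ li) ?ltxx// -yE yv.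
by under eq_bigr do rewrite lp; rewrite -scaler_suml l1 scale1r.
Qed.

(* A finite subset of [Q] determines the support function of [Q]. *)
Definition finitely_supported Q : Prop :=
  exists s : seq W, {in s, forall p, Q p} /\
    forall u q, Q q -> exists2 p, p \in s & dotv u q <= dotv u p.

Lemma finitely_supported0 : finitely_supported [set 0 : W].
Proof.
exists [:: 0]; split => [p|u _ ->]; first by rewrite inE => /eqP.
by exists 0; rewrite ?inE.
Qed.

Lemma finitely_supported_sum A B :
  finitely_supported A -> finitely_supported B ->
  finitely_supported (minkowski_sum A B).
Proof.
move=> [s [sA As]] [t [tB Bt]]; exists [seq a + b | a <- s, b <- t]; split.
  by move=> _ /allpairsP[[a b] /= [/sA Aa /tB Bb ->]]; exists a => //; exists b.
move=> u _ [a Aa [b Bb <-]].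
have [p ps ap] := As u a Aa; have [q qt bq] := Bt u b Bb.
by exists (p + q); [exact: allpairs_f|rewrite !dotvDr lerD].
Qed.

(** The generators of [P] lying on [F] suffice: in a convex combination that reaches the bound [b],
    every generator of positive weight reaches it too. *)
Lemma finitely_supported_face P F :
  is_polytope P -> is_face P F -> finitely_supported F.
Proof.
move=> [n [p PE]] [_ [a [b [ab ->]]]].
have Pp i : P (p i) by rewrite PE; exact: mem_convex_hull.
exists [seq p i | i <- enum 'I_n & dotv a (p i) == b]; split.
  by move=> _ /mapP[i + ->]; rewrite mem_filter => /andP[/eqP ib _]; split.
move=> u q [Pq /= qb]; move: (Pq); rewrite PE => -[l [l0 l1 qE]].
have [i li ui] := convex_comb_max p u l0 l1.
exists (p i); last by rewrite qE.
rewrite map_f// mem_filter mem_enum andbT; apply/eqP.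
by apply: (convex_comb_eq l0 l1 _ _ li) => [j _|]; [exact: ab|rewrite -qE qb].
Qed.

End ConvexCombinations.

(** * From support functions to indicator functions *)

Section EulerSeparation.
Variables (R : realType) (d : nat).
Local Notation W := 'rV[R]_d.

(* By separation, a point [x] is outside [Q] if and only if the polyhedron of
   all [u] with <u, q - x> <= -1 on [Q] is nonempty; the Euler characteristic
   therefore turns a relation in the dual variable [u] into one in [x]. *)
Lemma support_comb_eq0 (K : pzRingType) (I : finType) (a : I -> K)
    (Q : I -> set W) :
  (forall i, is_polyhedron (Q i)) -> (forall i, finitely_supported (Q i)) ->
  (forall u t, \sum_i a i * (`[< forall q, Q i q -> dotv u q <= t >])%:R = 0) ->
  forall x, \sum_i a i * (x \in Q i)%:R = 0.
Proof.
move=> PQ SQ H x.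
pose A i := [set u : W | forall q, Q i q -> dotv u q <= dotv u x - 1].
have PA i : is_polyhedron (A i).
  have [s [sQ Qs]] := SQ i.
  exists [seq (p - x, -1) | p <- s]; apply/seteqP; split => u /= Au.
    move=> _ /mapP[p ps ->] /=; rewrite dotvC dotvBr.
    by have := Au p (sQ p ps); lra.
  move=> q /(Qs u)[p ps]; have := Au _ (map_f _ ps).
  by rewrite /= dotvC dotvBr; lra.
have xQ i : (x \in Q i) = ~~ `[< A i !=set0 >].
  apply/idP/negP => [/set_mem Qx /asboolP[u /(_ x Qx)]|N]; first by lra.
  apply/mem_set; apply: contrapT => Qx; apply: N; apply/asboolP.
  have [s QE] := PQ i.
  have [c [cs cx]] : exists c, c \in s /\ c.2 < dotv c.1 x.
    apply: contrapT => N; apply: Qx; rewrite QE => c cs.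
    by rewrite leNgt; apply/negP => cx; apply: N; exists c.
  (* The normal of an inequality violated at [x], rescaled to make the gap 1. *)
  exists ((dotv c.1 x - c.2)^-1 *: c.1) => q; rewrite QE => /(_ c cs) cq.
  have e0 : 0 < dotv c.1 x - c.2 by rewrite subr_gt0.
  rewrite !dotvZl lerBrDl -[X in X + _](mulVf (lt0r_neq0 e0)) -mulrDr.
  by apply: ler_wpM2l; [rewrite invr_ge0 ltW|lra].
(* At [u = 0] and [t = 0] every condition in [H] holds. *)
have sa : \sum_i a i = 0.
  rewrite -[RHS](H 0 0); apply: eq_bigr => i _.
  by rewrite asboolT ?mulr1// => q _; rewrite dotv0l.
transitivity (\sum_i (a i - a i * (`[< A i !=set0 >])%:R)).
  apply: eq_bigr => i _; rewrite xQ; case: asboolP => _ /=.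
    by rewrite mulr0 mulr1 subrr.
  by rewrite mulr0 mulr1 subr0.
rewrite sumrB sa sub0r; apply/eqP; rewrite oppr_eq0; apply/eqP.
apply: euler_sum0 => // u; rewrite -[RHS](H u (dotv u x - 1)).
by apply: eq_bigr.
Qed.

End EulerSeparation.

(** * Iterated Minkowski sums and expansion of the product *)

Section Expansion.
Variables (R : realType) (d n : nat).
Local Notation W := 'rV[R]_d.
Implicit Types (B : 'I_n -> set W).

Definition minkowski_bigsum B : set W := \big[@minkowski_sum R d/[set 0]]_i B i.

Lemma minkowski_bigsumP B x : minkowski_bigsum B x <->
  exists2 y : 'I_n -> W, forall i, B i (y i) & x = \sum_i y i.
Proof.
rewrite /minkowski_bigsum; split.
  (* Uniqueness allows the value of [y] at the head to be set without disturbing the tail. *)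
  have H (s : seq 'I_n) : uniq s -> forall z,
      (\big[@minkowski_sum R d/[set 0]]_(i <- s) B i) z ->
      exists2 y : 'I_n -> W, {in s, forall i, B i (y i)} &
                             z = \sum_(i <- s) y i.
    elim: s => [|i s IH] /= us z.
      by rewrite big_nil => ->; exists (fun=> 0); rewrite ?big_nil.
    move: us => /andP[si us]; rewrite big_cons => -[a Ba [b /(IH us)[y yB ->] <-]].
    exists (fun j => if j == i then a else y j) => [j|].
      by rewrite inE; case: eqP => [->|_ /= /yB].
    rewrite big_cons eqxx; congr (_ + _); apply: eq_big_seq => j js.
    by case: eqP => // ji; rewrite -ji js in si.
  move=> /(H _ (index_enum_uniq _))[y yB ->]; exists y => // i.
  exact/yB/mem_index_enum.
move=> [y yB ->]; elim/big_rec2: _ => // i z A _ Az.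
by exists (y i) => //; exists z.
Qed.

Lemma minkowski_bigsum_polyhedron B : (forall i, is_polyhedron (B i)) ->
  is_polyhedron (minkowski_bigsum B).
Proof.
move=> PB; apply: big_ind => //; first exact: is_polyhedron1.
exact: is_polyhedron_sum.
Qed.

Lemma finitely_supported_bigsum B : (forall i, finitely_supported (B i)) ->
  finitely_supported (minkowski_bigsum B).
Proof.
move=> SB; apply: big_ind => //; first exact: finitely_supported0.
exact: finitely_supported_sum.
Qed.

Lemma minkowski_indic_prod B : (forall i, is_polyhedron (B i)) ->
  \prod_i minkowski_indic (B i) = minkowski_indic (minkowski_bigsum B).
Proof.
move=> PB; suff [] : is_polyhedron (minkowski_bigsum B) /\
  \prod_i minkowski_indic (B i) = minkowski_indic (minkowski_bigsum B) by [].
rewrite /minkowski_bigsum; elim/big_rec2: _ => [|i A u _ [PA ->]].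
  by split; [exact: is_polyhedron1|].
split; [exact: is_polyhedron_sum|exact: minkowski_indicM].
Qed.

(** [f] is the characteristic function of the subset S, and the Minkowski sum of this family is
    Q_S. *)
Definition face_choice P (F : 'I_n -> set W) (f : {ffun 'I_n -> bool}) i :=
  if f i then F i else P.

Lemma prod_indicB P (F : 'I_n -> set W) x :
  is_polyhedron P -> (forall i, is_polyhedron (F i)) ->
  (\prod_i (minkowski_indic P - minkowski_indic (F i))) x =
  \sum_(f : {ffun 'I_n -> bool}) (\prod_i (-1) ^+ f i) *
     (x \in minkowski_bigsum (face_choice P F f))%:R.
Proof.
move=> PP PF.
have PB f i : is_polyhedron (face_choice P F f i).
  by rewrite /face_choice; case: ifP.
(* Each difference becomes a sum over [bool], so distributivity yields a sum over choice
   functions. *)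
pose G i (b : bool) : minkowski_ring R d :=
  (-1) ^+ b *: minkowski_indic (if b then F i else P).
have -> : \prod_i (minkowski_indic P - minkowski_indic (F i)) =
    \prod_i \sum_(b : bool) G i b.
  apply: eq_bigr => i _; rewrite big_bool /G/=.
  by rewrite expr0 scale1r expr1 scaleN1r addrC.
rewrite bigA_distr_bigA/=.
have E (f : {ffun 'I_n -> bool}) : \prod_i G i (f i) =
    (\prod_i (-1) ^+ f i) *:
      minkowski_indic (minkowski_bigsum (face_choice P F f)).
  by rewrite -minkowski_indic_prod// scaler_prod.
under eq_bigr do rewrite E.
have sumE (r : seq {ffun 'I_n -> bool}) (g : _ -> minkowski_ring R d) :
    (\sum_(f <- r) g f) x = \sum_(f <- r) g f x.
  by elim: r => [|f r IH]; rewrite ?big_nil// !big_cons -IH.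
rewrite sumE; apply: eq_bigr => f _.
rewrite -[RHS]/(_ *: (_ : R[i]^o)) -indicE -minkowski_indicE//.
exact: minkowski_bigsum_polyhedron.
Qed.

End Expansion.

(** * The vertex-cover criterion *)

Theorem proposition4p16 (R : realType) (d : nat) (P : set 'rV[R]_d)
    (C : set (set 'rV[R]_d)) (hP : is_dpolytope P) (hC : C `<=` is_face P) :
  \big[*%R/1]_(F \in C) (face_indic P P - face_indic P F)
    = 0 :> face_ring P <->
  forall v : 'rV[R]_d, is_vertex P v -> exists2 F, C F & F v.
Proof.
have [polP [x0 [U [PU _]]]] := hP.
(* The affine hull contains [x0], and weights of sum 1 require at least one point of [P]. *)
have P0 : P !=set0.
  have : affine_hull P x0 by rewrite PU; exists 0; rewrite /= ?mem0v ?addr0.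
  move=> [[|n] [p [l [Pp /eqP]]]]; first by rewrite big_ord0 eq_sym oner_eq0.
  by exists (p ord0).
have faceP : is_face P P.
  split=> //; exists 0, 0; split=> [x _|]; first by rewrite dotv0l.
  by apply/seteqP; split=> [x Px|x []//]; split=> //=; rewrite dotv0l.
have PP := is_polytope_polyhedron polP.
have finC : finite_set C := sub_finite_set hC (finite_faces polP).
pose s : seq (set 'rV[R]_d) := finmap.enum_fset (fset_set C).
have sC F : (F \in s) = (F \in C) by rewrite in_fset_set.
pose n := size s; pose F (i : 'I_n) : set 'rV[R]_d := tnth (in_tuple s) i.
have CF i : C (F i) by apply/set_mem; rewrite -sC mem_tnth.
have FC G : C G -> exists i, F i = G.
  by move=> /mem_set; rewrite -sC => /(@tnthP _ _ (in_tuple s))[i ->]; exists i.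
have FP i : F i `<=` P by have [_ [a [b [_ ->]]]] := hC _ (CF i); move=> x [].
have PF i : is_polyhedron (F i) := is_face_polyhedron polP (hC _ (CF i)).
(* The inclusion of the face ring into the Minkowski ring is an injective ring morphism. *)
have -> : \big[*%R/1]_(F \in C) (face_indic P P - face_indic P F) = 0
      :> face_ring P <->
    \prod_i (minkowski_indic P - minkowski_indic (F i)) = 0.
  rewrite fsbig_finite//= -/s big_tnth.
  set X := \big[_/_]_(i < _) _.
  have -> : \prod_i (minkowski_indic P - minkowski_indic (F i)) = \val X.
    rewrite /X rmorph_prod; apply: eq_bigr => i _.
    by rewrite rmorphB /= !face_indicE//; exact/hC/CF.
  by split=> [->|XE]; [rewrite rmorph0|apply/val_inj; rewrite XE rmorph0].
split=> [prod0 v [_ [a [b [ab vE]]]]|cov].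
  have [Pv /= av] : (P `&` [set x | dotv a x = b]) v by rewrite -vE.
  apply: contrapT => uncov.
  have Fb i x : F i x -> dotv a x < b.
    move=> Fx; rewrite lt_neqAle ab ?andbT; last exact: FP Fx.
    apply/eqP => xb; apply: uncov; exists (F i) => //.
    suff <- : x = v by [].
    by rewrite -[x = v]/([set v] x) vE; split=> //; exact: FP Fx.
  have := congr1 (fun w : minkowski_ring R d => w (v *+ n)) prod0.
  rewrite prod_indicB// (bigD1 [ffun=> false])//= [X in _ + X]big1 => [|f fN].
    rewrite big1 => [|i _]; last by rewrite ffunE.
    rewrite mem_set ?mulr1 ?addr0 => [/eqP|]; first by rewrite oner_eq0.
    apply/minkowski_bigsumP; exists (fun=> v) => [i|].
      by rewrite /face_choice ffunE.
    by rewrite sumr_const card_ord.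
  rewrite memNset ?mulr0// => /minkowski_bigsumP[y yf nvE].
  have [i fi] : exists i, f i.
    apply: contrapT => N; move: fN => /eqP; apply; apply/ffunP => i.
    by rewrite ffunE; apply/negP => fi; apply: N; exists i.
  have yb j : dotv a (y j) <= b.
    have := yf j; rewrite /face_choice; case: ifP => _; last exact: ab.
    by move=> /Fb/ltW.
  (* One summand lies in some [F i], strictly below [b], whereas [v *+ n] has value [n] times
     [b]. *)
  have : \sum_j dotv a (y j) < \sum_(j < n) b.
    rewrite (bigD1 i)//= [ltRHS](bigD1 i)//=; apply: ltr_leD.
      by have := yf i; rewrite /face_choice fi => /Fb.
    exact: ler_sum.
  rewrite -dotv_sum -nvE -av sumr_const card_ord.
  by rewrite -scaler_nat dotvZr mulr_natl ltxx.
apply/val_inj/funext => x /=; rewrite prod_indicB//.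
pose Q f := minkowski_bigsum (face_choice P F f).
apply: (@support_comb_eq0 _ _ _ _ _ Q) => [f|f|u t].
- by apply: minkowski_bigsum_polyhedron => i; rewrite /face_choice; case: ifP.
- apply: finitely_supported_bigsum => i; rewrite /face_choice.
  by case: ifP => _; apply: finitely_supported_face polP _ => //; exact/hC/CF.
have [v vv umax] := polytope_vertex_max u polP P0.
have [G CG] := cov v vv; have [i <-] := FC G CG => Fv.
pose toggle (f : {ffun 'I_n -> bool}) := [ffun j => f j (+) (j == i)].
have toggleK : involutive toggle.
  by move=> f; apply/ffunP => j; rewrite !ffunE -addbA addbb addbF.
(* [v] lies in [F i] and maximizes [u] on [P], so [P] and [F i] contribute the
   same amount to the support function at [u]. *)
have bound_toggle (f g : {ffun _ -> bool}) : (forall j, j != i -> f j = g j) ->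
    (forall q, Q f q -> dotv u q <= t) -> forall q, Q g q -> dotv u q <= t.
  move=> fg ft _ /minkowski_bigsumP[y yg ->].
  pose z j := if j == i then v else y j.
  apply: (@le_trans _ _ (dotv u (\sum_j z j))).
    rewrite !dotv_sum; apply: ler_sum => j _; rewrite /z; case: eqP => // _.
    by apply: umax; have := yg j; rewrite /face_choice; case: ifP => // _ /FP.
  apply: ft; apply/minkowski_bigsumP; exists z => // j.
  rewrite /z; case: eqP => [->|/eqP ji].
    by rewrite /face_choice; case: ifP => // _; exact: FP Fv.
  by have := yg j; rewrite /face_choice fg.
(* [toggle] pairs terms of opposite sign, and 2 is not zero in [R[i]]. *)
set S := \sum_f _; suff : S = - S.
  by move/eqP; rewrite -addr_eq0 -mulr2n mulrn_eq0 => /eqP.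
rewrite {1}/S (reindex_inj (inv_inj toggleK)) -sumrN; apply: eq_bigr => f _.
rewrite -mulNr; congr (_ * (nat_of_bool _)%:R).
  rewrite (bigD1 i)//= [in RHS](bigD1 i)//= !ffunE eqxx addbT signrN mulNr.
  congr (- (_ * _)); apply: eq_bigr => j /negbTE ji.
  by rewrite !ffunE ji addbF.
apply: asbool_equiv_eq; split; apply: bound_toggle => j /negbTE ji;
  by rewrite ffunE ji addbF.
Qed.
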